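(* For any up-down tree $T$ with $t$ elements, as $n\to\infty$, \[ {\rm La}(n,T)\leq \left(1+\frac{16t}{n}+O\!\left(\frac{1}{n\sqrt{n\ln n}}\right)\right)\binom{n}{\lfloor n/2\rfloor}. \] Consequently, ${\rm La}(n,T)/\binom{n}{\lfloor n/2\rfloor}\to 1$ as $n\to\infty$.
   Context: A poset $(S,\leq)$ contains a poset $(S',\leq')$ if there is an injection $f\colon S'\to S$ such that $u\leq' v$ implies $f(u)\leq f(v)$ (copies need not be induced). For a poset $H$, a family $\mathcal{F}\subseteq 2^{[n]}$ is $H$-free if $(\mathcal{F},\subseteq)$ does not contain $H$, and ${\rm La}(n,H)$ is the maximum size of an $H$-free family of subsets of $[n]$. An up-down tree is a poset of height $2$ (largest chain has $2$ elements) whose Hasse diagram, viewed as an undirected graph, is a tree; its order is its number of elements. *)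

(* Defs.v *)
From mathcomp Require Import all_boot all_order all_algebra.
From mathcomp Require Import all_classical all_reals all_analysis.

Set Implicit Arguments.
Unset Strict Implicit.
Unset Printing Implicit Defensive.

Import Order.TTheory.

(* Not necessarily induced: comparabilities of S' are preserved, but need not
   be reflected. *)
Definition poset_contains (S S' : Type) (leS : rel S) (leS' : rel S') : Prop :=
  exists2 f : S' -> S,
    injective f & forall u v : S', leS' u v -> leS (f u) (f v).

Section Posets.
Context {d : Order.disp_t} (T : finPOrderType d).

Definition is_chain (A : {set T}) : bool :=
  [forall x in A, forall y in A, (x >=< y)%O].

Definition height : nat := \max_(A : {set T} | is_chain A) #|A|.

Definition covers (x y : T) : bool :=
  (x < y)%O && ~~ [exists z : T, (x < z)%O && (z < y)%O].

Definition hasse : rel T := fun x y => covers x y || covers y x.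

Definition free_of (n : nat) (F : {set {set 'I_n}}) : Prop :=
  ~ poset_contains
      (fun A B : {A : {set 'I_n} | A \in F} => val A \subset val B)
      (fun u v : T => (u <= v)%O).

Definition La (n : nat) : nat :=
  \max_(F : {set {set 'I_n}} | `[< free_of F >]) #|F|.

End Posets.

(* Cycles have at least 3 vertices: [ucycle e [:: x; y]] holds for every edge of
   a symmetric relation e. *)
Definition is_tree (V : finType) (e : rel V) : Prop :=
  [/\ (0 < #|V|)%N,
      forall x y : V, connect e x y
    & forall c : seq V, (2 < size c)%N -> ~ ucycle e c].

Definition up_down_tree (d : Order.disp_t) (T : finPOrderType d) : Prop :=
  height T = 2%N /\ is_tree (@hasse d T).

(* Main.v *)
Require Import Defs.
From mathcomp Require Import all_boot all_order all_algebra zify ring lra.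
Set Implicit Arguments.
Unset Strict Implicit.
Import Order.TTheory GRing.Theory Num.Theory.

(* Let X be the number of members of a T-free family F on a random maximal chain
   of subsets of [n]. Since X - 'C(X, 2) <= 1, the mean of X exceeds 1 by at most
   the total weight of the comparable pairs A < B in F, a pair being weighted by
   the probability that the chain meets both ends. A set of pairs in which every
   nonzero in- and out-degree is at least #|T| contains T greedily; hence in a
   T-free family the pairs can be charged to their ends, fewer than #|T| pairs per
   end. If all sizes are between n/4 and 3n/4, a pair weighs at most 4/n times
   either of its ends, so E X <= 1 + (8 #|T| / n) E X, giving
   E X <= 1 + 12 #|T| / n. The sets of other sizes are exponentially few, and
   contribute at most (4 / n) 'C(n, n./2). So the bound holds with error term 0
   for large n. The matching lower bound is the middle layer, an antichain. *)

(** * Binomial coefficients *)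

Lemma bin_leqS n k : 2 * k < n -> 'C(n, k) <= 'C(n, k.+1).
Proof.
move=> hk; rewrite -(@leq_pmul2l k.+1) // mul_bin_left leq_mul2r; lia.
Qed.

(** The ratio of the two coefficients is [(n - k) / (k + 1)], at least 2 in this range. *)
Lemma bin_double n k : 3 * k + 2 <= n -> 2 * 'C(n, k) <= 'C(n, k.+1).
Proof.
move=> hk; rewrite -(@leq_pmul2l k.+1) // mul_bin_left mulnA leq_mul2r; lia.
Qed.

Lemma leq_bin_half n k : 'C(n, k) <= 'C(n, n./2).
Proof.
have low j : j <= n./2 -> 'C(n, n./2 - j) <= 'C(n, n./2).
  elim: j => [|j IHj] hj; first by rewrite subn0.
  apply: leq_trans (IHj (ltnW hj)).
  have -> : n./2 - j = (n./2 - j.+1).+1 by lia.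
  by apply: bin_leqS; have := odd_double_half n; lia.
have [hk|hk] := leqP k n./2; first by have := low (n./2 - k); rewrite subKn //; apply; lia.
have [hn|hn] := leqP k n; last by rewrite bin_small.
by rewrite -(bin_sub hn); have := low (n./2 - (n - k)); rewrite subKn; [apply|]; lia.
Qed.

Lemma expn2_bin_leq n k j : 3 * (k + j) <= n.+1 -> 2 ^ j * 'C(n, k) <= 'C(n, n./2).
Proof.
move=> h; apply: leq_trans (leq_bin_half n (k + j)).
elim: j h => [|j IHj] h; first by rewrite mul1n addn0.
rewrite expnS -mulnA addnS; apply: leq_trans (@bin_double n (k + j) _); last by lia.
by rewrite leq_mul2l IHj //; lia.
Qed.

Lemma leq_sqr_expn2 n : 168 <= n -> n * n.+1 <= 2 ^ (n %/ 12) * 4.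
Proof.
(* With [j = n %/ 12], [n + 1 <= 12 * (j + 1)], so [n * (n + 1)] is at most [4 * 36 * (j + 1) ^ 2];
   and [168 = 12 * 14] gives [14 <= j]. *)
move=> hn; have h j : 14 <= j -> 36 * (j.+1 * j.+1) <= 2 ^ j.
  elim: j => [//|j IHj]; rewrite leq_eqVlt => /orP[/eqP <-|]; first by vm_compute.
  by rewrite ltnS expnS => hj; have := IHj hj; nia.
by have := h (n %/ 12); nia.
Qed.

(** Coefficients double at each step up to about n/3; starting below n/4 leaves n/3 - n/4 = n/12
    doublings. Large [k] is reflected to [n - k]. *)
Lemma bin_outer_leq n k : k <= n -> (4 * k < n) || (3 * n < 4 * k) ->
  2 ^ (n %/ 12) * 'C(n, k) <= 'C(n, n./2).
Proof.
move=> kn /orP[h|h]; first by apply: expn2_bin_leq; lia.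
by rewrite -(bin_sub kn); apply: expn2_bin_leq; lia.
Qed.

Lemma card_outer_sets n : 168 <= n ->
  n * #|[set A : {set 'I_n} | (4 * #|A| < n) || (3 * n < 4 * #|A|)]|
  <= 4 * 'C(n, n./2).
Proof.
move=> hn; set P := fun k => (4 * k < n) || (3 * n < 4 * k).
have -> : #|[set A : {set 'I_n} | P #|A|]| = \sum_(k < n.+1 | P k) 'C(n, k).
  rewrite -sum1_card (partition_big (fun A : {set 'I_n} => inord #|A| : 'I_n.+1) P) /=.
    apply: eq_bigr => k Pk; have := card_draws 'I_n k; rewrite card_ord => <-; rewrite -sum1_card.
    apply: eq_bigl => A; rewrite !inE -val_eqE /= inordK ?ltnS; last first.
      by rewrite -[X in _ <= X]card_ord max_card.
    by case: eqP => [->|]; rewrite ?andbT ?andbF.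
  by move=> A; rewrite inE inordK // ltnS -[X in _ <= X]card_ord max_card.
rewrite -(@leq_pmul2l (2 ^ (n %/ 12))) ?expn_gt0 //.
have : 2 ^ (n %/ 12) * \sum_(k < n.+1 | P k) 'C(n, k) <= n.+1 * 'C(n, n./2).
  rewrite big_distrr /=; apply: (@leq_trans (\sum_(k < n.+1) 'C(n, n./2))).
    rewrite big_mkcond; apply: leq_sum => k _; case: ifP => // Pk.
    by apply: bin_outer_leq => //; rewrite -ltnS.
  by rewrite sum_nat_const card_ord.
have := @leq_sqr_expn2 n hn; set a := \sum_(_ < _ | _) _; set b := 2 ^ _; set c := 'C(_, _).
move=> h1 h2; rewrite mulnCA (leq_trans (leq_mul (leqnn n) h2)) // mulnA [X in _ <= X]mulnA.
by rewrite leq_mul2r h1 orbT.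
Qed.

Lemma leq_bin_self m k : (0 < k < m -> m <= 'C(m, k))%N.
Proof.
elim: m k => [|m IHm] [//|k]; first by rewrite andbF.
rewrite ltnS => /= km; rewrite binS; have [lt|] := ltnP k.+1 m.
  have c0 : (0 < 'C(m, k))%N by rewrite bin_gt0; lia.
  by have := IHm k.+1 lt; lia.
move=> h; have -> : m = k.+1 by lia.
by rewrite binn binSn; lia.
Qed.

(** Both sides count nested pairs of sets of sizes [a] and [b], choosing the larger or the smaller
    set first. *)
Lemma mul_bin_bin n b a : (a <= b <= n)%N ->
  ('C(n, b) * 'C(b, a) = 'C(n, a) * 'C(n - a, b - a))%N.
Proof.
case/andP=> ab bn; have an := leq_trans ab bn.
have e1 := bin_fact bn; have e2 := bin_fact ab; have e3 := bin_fact an.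
have e4 := @bin_fact (n - a) (b - a) ltac:(lia).
have e5 : (n - a - (b - a) = n - b)%N by lia.
rewrite e5 in e4.
have p : (0 < a`! * (b - a)`! * (n - b)`!)%N by rewrite !muln_gt0 !fact_gt0.
apply/eqP; rewrite -(eqn_pmul2r p); apply/eqP.
transitivity n`!; first by rewrite -e1 -e2; ring.
by rewrite -e3 -e4; ring.
Qed.

(** * Greedy embedding of up-down trees *)

Section UpDownTree.
Context {d : Order.disp_t} {T : finPOrderType d}.
Hypothesis hT : up_down_tree T.

Lemma up_down_tree_lt : exists x y : T, (x < y)%O.
Proof.
have [ht _] := hT.
have [|A chA cA] := @eq_bigmax_cond {set T} (@is_chain d T) (fun A => #|A|).
  by apply/card_gt0P; exists set0; apply/forall_inP => x; rewrite inE.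
have /cards2P[x [y [xy eA]]] : #|A| == 2%N by rewrite -cA -ht.
move: chA; rewrite eA => /forall_inP/(_ x); rewrite !inE eqxx => /(_ isT).
move/forall_inP/(_ y); rewrite !inE eqxx orbT => /(_ isT).
rewrite /Order.comparable !le_eqVlt [y == x]eq_sym (negbTE xy) /=.
by case/orP=> ?; [exists x, y | exists y, x].
Qed.

Lemma up_down_tree_lt_lt (x y z : T) : (x < y)%O -> (y < z)%O -> False.
Proof.
move=> xy yz; have xz := lt_trans xy yz; have [ht _] := hT.
suff: #|x |: [set y; z]| <= 2.
  by rewrite cardsU1 cards2 !inE negb_or (lt_eqF xy) (lt_eqF xz) (lt_eqF yz).
rewrite -ht; apply: (@leq_bigmax_cond _ (@is_chain d T) (fun A => #|A|)).
apply/forall_inP => u; rewrite !inE => uA; apply/forall_inP => v; rewrite !inE => vA.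
move: (ltW xy) (ltW xz) (ltW yz) => {}xy {}xz {}yz; rewrite /Order.comparable.
by case/or3P: uA => /eqP->; case/or3P: vA => /eqP->; rewrite ?lexx ?xy ?xz ?yz ?orbT.
Qed.

(** Every strict comparability is thus an edge of the tree, so an embedding only has to respect tree
    edges. *)
Lemma up_down_tree_covers (x y : T) : (x < y)%O -> covers x y.
Proof.
move=> xy; rewrite /covers xy /=; apply/existsPn => z; apply/negP => /andP[xz zy].
exact: up_down_tree_lt_lt xz zy.
Qed.

Lemma hasse_sym : symmetric (@hasse d T).
Proof. by move=> x y; rewrite /hasse orbC. Qed.

(** The path has to stay inside [S], which [connect] for the Hasse relation on [T] would not
    ensure. *)
Definition connected_on (S : {set T}) : Prop := {in S &, forall x y, exists p : seq T,
  [/\ path (@hasse d T) x p, all (mem S) p & last x p = y]}.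

(* A second edge from y to S would close a cycle. *)
Lemma connected_on_hasse_uniq (S : {set T}) (x x' y : T) : connected_on S ->
  x \in S -> x' \in S -> y \notin S -> hasse x y -> hasse x' y -> x' = x.
Proof.
move=> cS xS x'S yS hxy hx'y; have [_ [_ _ acyc]] := hT.
apply/eqP/negPn/negP => xx'.
have [p [hp pS ep]] := cS _ _ xS x'S.
(* A cycle must not repeat vertices, so the path from [x] to [x'] is made simple; it is nonempty
   because [x] and [x'] differ. *)
case/shortenP: hp ep => q hq uq sub_q eq.
case: (acyc (y :: x :: q)) => [|].
  by case: q eq {hq uq sub_q} => [/= e|//]; rewrite e eqxx in xx'.
rewrite /ucycle /= rcons_path eq hasse_sym hxy hq hx'y /=.
rewrite -/(uniq (x :: q)) uq andbT inE negb_or; apply/andP; split.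
  by apply: contraNneq yS => ->.
by apply: contra yS => /sub_q yp; move/allP: pS => /(_ _ yp).
Qed.

Lemma connected_on_setU1 (S : {set T}) (x y : T) : connected_on S ->
  x \in S -> hasse x y -> connected_on (y |: S).
Proof.
move=> cS xS hxy.
have wk p : all (mem S) p -> all (mem (y |: S)) p.
  by apply: sub_all => z; rewrite /= !inE => ->; rewrite orbT.
move=> u v; rewrite !inE => /predU1P[->|uS] /predU1P[->|vS].
- by exists [::].
- have [p [hp pS ep]] := cS _ _ xS vS.
  by exists (x :: p); rewrite /= hasse_sym hxy hp wk // !inE xS orbT.
- have [p [hp pS ep]] := cS _ _ uS xS.
  exists (rcons p y); rewrite rcons_path hp ep hxy all_rcons wk // last_rcons.
  by rewrite /= !inE eqxx.
- by have [p [hp pS ep]] := cS _ _ uS vS; exists p; rewrite hp wk.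
Qed.

Lemma hasse_exit (S : {set T}) : S != set0 -> S != setT ->
  exists x y, [/\ x \in S, y \notin S & hasse x y].
Proof.
case/set0Pn=> x xS nS; have [_ [_ conn _]] := hT.
have /subsetPn[y _ yS] : ~~ ([set: T] \subset S) by rewrite subTset.
have /connectP[p hp ey] := conn x y; move: yS; rewrite {}ey.
elim: p x xS hp => [|z p IHp] x xS /=; first by rewrite xS.
case/andP=> hxz hp; have [zS|zS] := boolP (z \in S); first exact: IHp.
by move=> _; exists x, z.
Qed.

(** * Growing an embedding in a digraph whose nonzero degrees are large *)

Section Embedding.
Variables (V : finType) (E : {set V * V}).

Definition out_nbrs (E : {set V * V}) v := [set w | (v, w) \in E].
Definition in_nbrs (E : {set V * V}) w := [set v | (v, w) \in E].

Hypothesis out_large : forall v, out_nbrs E v != set0 -> #|T| <= #|out_nbrs E v|.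
Hypothesis in_large : forall v, in_nbrs E v != set0 -> #|T| <= #|in_nbrs E v|.

(** The last two clauses look ahead: an element with a relation still to be embedded already sits at
    a vertex of nonzero, hence large, degree in that direction. *)
Let good (S : {set T}) (f : T -> V) : Prop :=
  [/\ connected_on S, {in S &, injective f},
      {in S &, forall u v, (u < v)%O -> (f u, f v) \in E},
      {in S, forall u v, (u < v)%O -> out_nbrs E (f u) != set0}
    & {in S, forall v u, (u < v)%O -> in_nbrs E (f v) != set0}].

Lemma large_fresh (S : {set T}) (f : T -> V) (N : {set V}) y :
  y \notin S -> #|T| <= #|N| -> exists2 w, w \in N & w \notin f @: S.
Proof.
move=> yS hN; apply/subsetPn; apply/negP => /subset_leq_card.
apply/negP; rewrite -ltnNge; apply: leq_trans hN.
apply: (leq_ltn_trans (leq_imset_card _ _)).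
rewrite -cardsT; apply: proper_card; apply/properP; split; first exact: subsetT.
by exists y; rewrite ?inE.
Qed.

Lemma good_extend S f : S != set0 -> S != setT -> good S f ->
  exists y f', y \notin S /\ good (y |: S) f'.
Proof.
move=> S0 ST [cS injf edg outf inf].
have [x [y [xS yS hxy]]] := hasse_exit S0 ST.
have yNS u : u \in S -> (u == y) = false.
  by move=> uS; apply: contraNF yS => /eqP <-.
have uniq_nbr u : u \in S -> hasse u y -> u = x.
  by move=> uS huy; apply: (connected_on_hasse_uniq cS xS uS yS).
have inj' w : w \notin f @: S ->
    {in y |: S &, injective (fun u => if u == y then w else f u)}.
  move=> wS u v; rewrite !inE => /predU1P[->|uS] /predU1P[->|vS] //;
    rewrite ?eqxx ?yNS //.
  - by move=> e; case/negP: wS; rewrite e imset_f.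
  - by move=> e; case/negP: wS; rewrite -e imset_f.
  - exact: injf.
exists y; case/orP: (hxy) => /andP[xy _].
- have [w] := large_fresh f yS (out_large (outf _ xS _ xy)).
  rewrite inE => xw wS; exists (fun u => if u == y then w else f u).
  split=> //; split; [exact: connected_on_setU1 hxy | exact: inj' | | |].
  + move=> u v; rewrite !inE => /predU1P[->|uS] /predU1P[->|vS] uv.
    * by rewrite ltxx in uv.
    * by case: (up_down_tree_lt_lt xy uv).
    * have -> : u = x by apply: uniq_nbr; rewrite // /hasse up_down_tree_covers.
      by rewrite yNS // eqxx.
    * by rewrite !yNS //; apply: edg.
  + move=> u; rewrite !inE => /predU1P[->|uS] v uv.
      by case: (up_down_tree_lt_lt xy uv).
    by rewrite yNS //; apply: outf uv.
  + move=> v; rewrite !inE => /predU1P[->|vS] u uv.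
      (* The edge just used, from [f x] to the image of [y], shows that this in-degree is
         nonzero. *)
      by apply/set0Pn; exists (f x); rewrite eqxx inE.
    by rewrite yNS //; apply: inf uv.
- have [w] := large_fresh f yS (in_large (inf _ xS _ xy)).
  rewrite inE => xw wS; exists (fun u => if u == y then w else f u).
  split=> //; split; [exact: connected_on_setU1 hxy | exact: inj' | | |].
  + move=> u v; rewrite !inE => /predU1P[->|uS] /predU1P[->|vS] uv.
    * by rewrite ltxx in uv.
    * have -> : v = x by apply: uniq_nbr; rewrite // /hasse (up_down_tree_covers uv) orbT.
      by rewrite eqxx yNS.
    * by case: (up_down_tree_lt_lt uv xy).
    * by rewrite !yNS //; apply: edg.
  + move=> u; rewrite !inE => /predU1P[->|uS] v uv.
      by apply/set0Pn; exists (f x); rewrite eqxx inE.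
    by rewrite yNS //; apply: outf uv.
  + move=> v; rewrite !inE => /predU1P[->|vS] u uv.
      by case: (up_down_tree_lt_lt uv xy).
    by rewrite yNS //; apply: inf uv.
Qed.

Lemma up_down_tree_embeds : E != set0 ->
  exists2 f : T -> V, injective f & forall u v, (u < v)%O -> (f u, f v) \in E.
Proof.
case/set0Pn=> -[a b] ab; have [x0 [y0 xy0]] := up_down_tree_lt.
suff [f [_ injf edg _ _]] : exists f, good setT f.
  by exists f => [u v|u v uv]; [apply: injf | apply: edg].
suff step m : m < #|T| -> exists (S : {set T}) f, #|S| = m.+1 /\ good S f.
  have T0 : 0 < #|T| by apply/card_gt0P; exists x0.
  have [|S [f [cS gS]]] := step #|T|.-1; first by rewrite prednK.
  exists f; suff <- : S = setT by [].
  by apply/eqP; rewrite eqEcard subsetT cardsT cS prednK /=.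
elim: m => [|m IHm] hm.
  (* The minimal element [x0] starts at the tail of an edge: [b] witnesses its out-degree, and
     nothing lies below it. *)
  exists [set x0], (fun _ => a); rewrite cards1; split=> //; split.
  - by move=> u v; rewrite !inE => /eqP-> /eqP->; exists [::].
  - by move=> u v; rewrite !inE => /eqP-> /eqP->.
  - by move=> u v; rewrite !inE => /eqP-> /eqP->; rewrite ltxx.
  - by move=> u _ v _; apply/set0Pn; exists b; rewrite inE.
  - move=> v; rewrite inE => /eqP-> u uv.
    by case: (up_down_tree_lt_lt uv xy0).
have [S [f [cS gS]]] := IHm (ltnW hm).
have [||y [f' [yS gS']]] := good_extend _ _ gS.
- by rewrite -card_gt0 cS.
- by apply: contraTneq hm => e; rewrite -cS e cardsT ltnn.
by exists (y |: S), f'; rewrite cardsU1 yS cS.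
Qed.

End Embedding.
End UpDownTree.

Local Open Scope ring_scope.

(** * Chains and comparable pairs *)

Section LYM.
Variables (R : realFieldType) (n : nat).
Implicit Types (A B : {set 'I_n}) (h : {set 'I_n} -> R).

(* The expectation of the sum of h over the proper subsets of B lying on a
   uniformly random maximal chain from the empty set to B. *)
Definition chain_mean h B : R :=
  \sum_(A : {set 'I_n} | A \proper B) h A / 'C(#|B|, #|A|)%:R.

Lemma chain_mean_ge0 h B : (forall A, 0 <= h A) -> 0 <= chain_mean h B.
Proof. by move=> h0; apply: sumr_ge0 => A _; rewrite divr_ge0. Qed.

Lemma chain_meanB h h' B :
  chain_mean (fun A => h A - h' A) B = chain_mean h B - chain_mean h' B.
Proof. by rewrite -sumrB; apply: eq_bigr => A _; rewrite mulrBl. Qed.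

Lemma chain_mean_set0 h : chain_mean h set0 = 0.
Proof. by rewrite /chain_mean big_pred0 // => A; rewrite properE sub0set andbF. Qed.

(** The chain is conditioned on its last set before [B], which is [B :\ b] for a uniformly random
    [b]. *)
Lemma chain_meanE h B : B != set0 ->
  chain_mean h B = #|B|%:R^-1 * \sum_(b in B) (h (B :\ b) + chain_mean h (B :\ b)).
Proof.
move=> B0; have cB0 : (0 < #|B|)%N by rewrite card_gt0.
have -> : \sum_(b in B) (h (B :\ b) + chain_mean h (B :\ b)) =
    \sum_(b in B) \sum_(A : {set 'I_n} | A \subset B :\ b) h A / 'C(#|B|.-1, #|A|)%:R.
  apply: eq_bigr => b bB; rewrite (bigD1 (B :\ b)) //=.
  have -> : #|B|.-1 = #|B :\ b| by rewrite [#|B|](cardsD1 b) bB.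
  rewrite binn divr1; congr (_ + _); apply: eq_bigl => A.
  by rewrite properEneq andbC.
rewrite (exchange_big_dep (fun A : {set 'I_n} => A \proper B)) /=; last first.
  move=> b A bB; rewrite subsetD1 => /andP[AB bA].
  by apply/properP; split=> //; exists b.
rewrite big_distrr; apply: eq_bigr => A AB /=.
have [sAB _] := properP AB; have ltAB := proper_card AB.
(* After the exchange, a fixed [A] is counted once for each [b] in [B :\: A]. *)
rewrite (eq_bigl (mem (B :\: A))); last first.
  by move=> b; rewrite !inE subsetD1 sAB /= andbC.
rewrite sumr_const cardsD (setIidPr sAB) -mulr_natl.
have e : (#|B| * 'C(#|B|.-1, #|A|) = (#|B| - #|A|) * 'C(#|B|, #|A|))%N.
  by rewrite mul_bin_down.
have {}e : #|B|%:R * 'C(#|B|.-1, #|A|)%:R = (#|B| - #|A|)%:R * 'C(#|B|, #|A|)%:R :> R.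
  by rewrite -!natrM e.
have c1 : 'C(#|B|, #|A|)%:R != 0 :> R by rewrite pnatr_eq0 -lt0n bin_gt0 ltnW.
have c2 : 'C(#|B|.-1, #|A|)%:R != 0 :> R by rewrite pnatr_eq0 -lt0n bin_gt0; lia.
have c3 : #|B|%:R != 0 :> R by rewrite pnatr_eq0 -lt0n.
apply: (mulIf c1); apply: (mulIf c2); apply: (mulIf c3).
rewrite [LHS](_ : _ = h A * (#|B|%:R * 'C(#|B|.-1, #|A|)%:R)); last by field.
by rewrite e; field; rewrite c2 c3.
Qed.

Variable F : {set {set 'I_n}}.
Let chi A : R := (A \in F)%:R.
(** The expected contribution of [A] to X - 'C(X, 2) once the chain passes through [A]: each pair is
    counted at its larger member. *)
Let defect A : R := chi A - chi A * chain_mean chi A.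

(* X - 'C(X, 2) <= 1 in expectation, where X is the number of members of F on a
   random maximal chain of subsets of B. *)
Lemma chain_mean_defect_le1 B : defect B + chain_mean defect B <= 1.
Proof.
have chi0 A : 0 <= chi A by rewrite ler0n.
have [m] := ubnP #|B|; elim: m B => [//|m IHm] B cB.
rewrite {1}/defect; have [BF|BF] := boolP (B \in F); last first.
  rewrite /chi (negbTE BF) mul0r subr0 add0r.
  have [->|B0] := eqVneq B set0; first by rewrite chain_mean_set0.
  rewrite chain_meanE // ler_pdivrMl ?ltr0n ?card_gt0 // mulr1 -sumr_const.
  by apply: ler_sum => b bB; apply: IHm; move: cB; rewrite (cardsD1 b) bB add1n ltnS.
have -> : chi B = 1 by rewrite /chi BF.
(* For [B] in [F], the mean of [chi] subtracted in [defect B] cancels against the one in the mean of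
   [defect], leaving 1 minus a nonnegative mean. *)
rewrite mul1r (chain_meanB chi) addrA subrK lerBlDr lerDl.
by apply: chain_mean_ge0 => A; rewrite mulr_ge0 ?chain_mean_ge0.
Qed.

(** This is the defect bound at the full set. Each term of the double sum is the probability that a
    random maximal chain meets both [A] and [B]; for an antichain this is the LYM inequality. *)
Lemma lym_pairs :
  \sum_(A in F) 'C(n, #|A|)%:R^-1 <=
  1 + \sum_(B in F) \sum_(A in F | A \proper B) ('C(n, #|B|)%:R * 'C(#|B|, #|A|)%:R)^-1 :> R.
Proof.
have := chain_mean_defect_le1 setT.
have -> : defect setT + chain_mean defect setT = \sum_(A : {set 'I_n}) defect A / 'C(n, #|A|)%:R.
  rewrite [RHS](bigD1 setT) //= cardsT card_ord binn divr1; congr (_ + _).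
  rewrite /chain_mean cardsT card_ord; apply: eq_bigl => A.
  by rewrite properT.
rewrite (eq_bigr (fun A => chi A / 'C(n, #|A|)%:R - chi A * chain_mean chi A / 'C(n, #|A|)%:R)); last first.
  by move=> A _; rewrite mulrBl.
rewrite sumrB lerBlDr; congr (_ <= 1 + _).
  rewrite [RHS]big_mkcond; apply: eq_bigr => A _; rewrite /chi.
  by case: ifP; rewrite ?mul1r ?mul0r.
rewrite [RHS]big_mkcond; apply: eq_bigr => B _; rewrite /chi.
case: ifP; rewrite ?mul0r // mul1r /chain_mean => _.
rewrite big_distrl /= [RHS]big_mkcondl; apply: eq_bigr => A _.
by case: ifP; rewrite ?mul0r // mul1r invfM mulrC.
Qed.

End LYM.

(** * Charging *)

Section Charging.
Context {R : realFieldType} {V : finType}.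
Implicit Types (E : {set V * V}) (e : V * V -> R).

Lemma ler_sum_subset (A B : {set V}) (g : V -> R) : (forall v, 0 <= g v) ->
  A \subset B -> \sum_(v in A) g v <= \sum_(v in B) g v.
Proof.
move=> g0 /subsetP AB; rewrite [X in X <= _]big_mkcond [X in _ <= X]big_mkcond.
by apply: ler_sum => v _; case: ifP => [/AB -> //|_]; case: ifP.
Qed.

Lemma card_out_fiber E v : #|[set p in E | p.1 == v]| = #|out_nbrs E v|.
Proof.
rewrite -(@card_imset _ _ (fun w => (v, w)) (mem (out_nbrs E v))); last by move=> w w' [].
apply: eq_card => -[a b]; rewrite !inE /=; apply/andP/imsetP => [[ab /eqP <-]|[w]].
  by exists b; rewrite ?inE.
by rewrite inE => vw [-> ->].
Qed.

Lemma card_in_fiber E v : #|[set p in E | p.2 == v]| = #|in_nbrs E v|.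
Proof.
rewrite -(@card_imset _ _ (fun w => (w, v)) (mem (in_nbrs E v))); last by move=> w w' [].
apply: eq_card => -[a b]; rewrite !inE /=; apply/andP/imsetP => [[ab /eqP <-]|[w]].
  by exists a; rewrite ?inE.
by rewrite inE => vw [-> ->].
Qed.

(** One charging step: [pi] is the chosen end ([fst] or [snd]), and the edges at [v] are paid for by
    [v]. *)
Lemma sum_edges_fiber E e (pi : V * V -> V) (g : V -> R) v k :
  (forall w, 0 <= g w) -> {in E, forall p, e p <= g (pi p)} ->
  (#|[set p in E | pi p == v]| <= k)%N ->
  \sum_(p in E) e p <= k%:R * g v + \sum_(p in [set p in E | pi p != v]) e p.
Proof.
move=> g0 eg hk; rewrite (bigID (fun p => pi p == v)) /=; apply: lerD; last first.
  by rewrite le_eqVlt; apply/orP; left; apply/eqP/eq_bigl => p; rewrite inE.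
apply: (@le_trans _ _ (#|[set p in E | pi p == v]|%:R * g v)); last first.
  by rewrite ler_wpM2r // ler_nat.
rewrite mulr_natl -sumr_const [X in _ <= X](eq_bigl (fun p => (p \in E) && (pi p == v))).
  by apply: ler_sum => p /andP[pE /eqP <-]; apply: eg.
by move=> p; rewrite inE.
Qed.

(** Once its edges are deleted, [v] is no longer an end on that side, so it is charged there only
    once. *)
Lemma sum_image_fiber E (pi : V * V -> V) (g : V -> R) v :
  (forall w, 0 <= g w) -> v \in pi @: E ->
  g v + \sum_(w in pi @: [set p in E | pi p != v]) g w <= \sum_(w in pi @: E) g w.
Proof.
move=> g0 vE; rewrite [X in _ <= X](big_setD1 v) //= lerD2l; apply: ler_sum_subset => //.
apply/subsetP => _ /imsetP[p + ->]; rewrite !inE => /andP[pE ->] /=.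
exact: imset_f.
Qed.

End Charging.

Section Degenerate.
Context {d : Order.disp_t} {T : finPOrderType d}.
Hypothesis hT : up_down_tree T.
Context {R : realFieldType} {V : finType}.
Variables (e : V * V -> R) (alpha beta : V -> R).
Hypotheses (alpha_ge0 : forall v, 0 <= alpha v) (beta_ge0 : forall v, 0 <= beta v).

(* Without a copy of T some edge has an end of degree less than #|T|; charge the
   edges there to that end, delete them, and iterate. *)
Lemma sum_edges_le (E : {set V * V}) :
  {in E, forall p, e p <= alpha p.1} -> {in E, forall p, e p <= beta p.2} ->
  ~ (exists2 f : T -> V, injective f & forall u v, (u < v)%O -> (f u, f v) \in E) ->
  \sum_(p in E) e p <=
  #|T|%:R * (\sum_(v in fst @: E) alpha v + \sum_(v in snd @: E) beta v).
Proof.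
have [m] := ubnP #|E|; elim: m E => [//|m IHm] E cE ha hb nf.
have [->|E0] := eqVneq E set0.
  by rewrite big_set0 mulr_ge0 // addr_ge0 // sumr_ge0.
have IH (pi : V * V -> V) v : v \in pi @: E ->
    let E' := [set p in E | pi p != v] in E' \subset E /\ \sum_(p in E') e p <=
      #|T|%:R * (\sum_(v in fst @: E') alpha v + \sum_(v in snd @: E') beta v).
  move=> /imsetP[p0 p0E ev] E'.
  have sE : E' \subset E by apply/subsetP => p; rewrite inE => /andP[].
  split=> //; apply: IHm => [|p /(subsetP sE)|p /(subsetP sE)|[f injf hf]].
  - rewrite -ltnS; apply: leq_trans cE; rewrite ltnS; apply: proper_card; apply/properP; split=> //.
    by exists p0; rewrite // inE ev eqxx andbF.
  - exact: ha.
  - exact: hb.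
  - by apply: nf; exists f => // u v' uv; apply/(subsetP sE)/hf.
have [/forallP out_large|/forallPn[v]] :=
    boolP [forall v, (out_nbrs E v != set0) ==> (#|T| <= #|out_nbrs E v|)%N]; last first.
  rewrite negb_imply -ltnNge => /andP[/set0Pn[w]]; rewrite inE => vw vT.
  have vE : v \in fst @: E by apply/imsetP; exists (v, w).
  have [sE le'] := IH fst v vE.
  have hf : (#|[set p in E | p.1 == v]| <= #|T|)%N by rewrite card_out_fiber ltnW.
  apply: (le_trans (sum_edges_fiber alpha_ge0 ha hf)); apply: (le_trans (lerD (lexx _) le')).
  rewrite -mulrDr addrA ler_wpM2l // lerD ?sum_image_fiber //.
  by rewrite ler_sum_subset ?imsetS.
have [/forallP in_large|/forallPn[v]] :=
    boolP [forall v, (in_nbrs E v != set0) ==> (#|T| <= #|in_nbrs E v|)%N]; last first.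
  rewrite negb_imply -ltnNge => /andP[/set0Pn[w]]; rewrite inE => vw vT.
  have vE : v \in snd @: E by apply/imsetP; exists (w, v).
  have [sE le'] := IH snd v vE.
  have hf : (#|[set p in E | p.2 == v]| <= #|T|)%N by rewrite card_in_fiber ltnW.
  apply: (le_trans (sum_edges_fiber beta_ge0 hb hf)); apply: (le_trans (lerD (lexx _) le')).
  rewrite -mulrDr addrCA ler_wpM2l // lerD ?sum_image_fiber //.
  by rewrite ler_sum_subset ?imsetS.
(* No end of small degree remains, so the greedy embedding yields the excluded copy of [T]. *)
by case: nf; apply: up_down_tree_embeds => // v; apply/implyP.
Qed.

End Degenerate.

(** * Bounds on La *)

Section MiddleFamily.
Context {d : Order.disp_t} {T : finPOrderType d}.
Hypothesis hT : up_down_tree T.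
Variable R : realFieldType.

Let weight n (A : {set 'I_n}) : R := 'C(n, #|A|)%:R^-1.

(** Relative to [B] the extra factor is ['C(#|B|, #|A|)], at least [#|B|]; relative to [A] it is
    ['C(n - #|A|, #|B| - #|A|)], at least [n - #|A|]. Both are at least n/4. *)
Lemma pair_weight_le n (A B : {set 'I_n}) : A \proper B ->
  (n <= 4 * #|A|)%N -> (4 * #|B| <= 3 * n)%N -> (0 < n)%N ->
  let e := ('C(n, #|B|)%:R * 'C(#|B|, #|A|)%:R)^-1 in
  e <= 4 / n%:R * weight A /\ e <= 4 / n%:R * weight B.
Proof.
move=> AB hA hB n0 e; rewrite /weight; have lt := proper_card AB.
have n0' : 0 < n%:R :> R by rewrite ltr0n.
have cA : (0 < 'C(n, #|A|))%N by rewrite bin_gt0; lia.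
have cB : (0 < 'C(n, #|B|))%N by rewrite bin_gt0; lia.
have aux (c m : nat) : (0 < 'C(n, c))%N -> (n <= 4 * m)%N ->
    ('C(n, c)%:R * m%:R)^-1 <= 4 / n%:R * 'C(n, c)%:R^-1 :> R.
  move=> c0 nm; rewrite invfM mulrC ler_wpM2r ?invr_ge0 //.
  rewrite -[4 / _]invf_div lef_pV2 ?posrE ?divr_gt0 ?ltr0n //; last by lia.
  by rewrite ler_pdivrMr // -natrM ler_nat mulnC.
split.
- rewrite /e -natrM mul_bin_bin ?natrM; last by lia.
  have hA' : (n <= 4 * (n - #|A|))%N by lia.
  apply: le_trans (aux _ _ cA hA').
  rewrite lef_pV2 ?posrE ?mulr_gt0 ?ltr0n ?bin_gt0 //; try lia.
  by rewrite ler_pM2l ?ltr0n // ler_nat leq_bin_self //; lia.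
- rewrite /e; have hB' : (n <= 4 * #|B|)%N by lia.
  apply: le_trans (aux _ _ cB hB').
  rewrite lef_pV2 ?posrE ?mulr_gt0 ?ltr0n ?bin_gt0 //; try lia.
  by rewrite ler_pM2l ?ltr0n // ler_nat leq_bin_self //; lia.
Qed.

(** No element is isolated, so a map sending relations to pairs in [F] has its whole image in
    [F]. *)
Lemma hasse_nbr (u : T) : exists v, hasse u v.
Proof.
have [x [y xy]] := up_down_tree_lt hT.
have [||_ [v [/set1P-> _ ?]]] := @hasse_exit _ _ hT [set u]; last by exists v.
  by apply/set0Pn; exists u; rewrite inE.
apply/eqP => e; have := in_setT x; have := in_setT y; rewrite -e !inE.
by move=> /eqP ey /eqP ex; rewrite ex ey ltxx in xy.
Qed.

Lemma middle_family_weight n (F : {set {set 'I_n}}) : (0 < n)%N -> free_of T F ->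
  {in F, forall A : {set 'I_n}, (n <= 4 * #|A|)%N /\ (4 * #|A| <= 3 * n)%N} ->
  \sum_(A in F) weight A <= 1 + (8 * #|T|)%:R / n%:R * \sum_(A in F) weight A.
Proof.
move=> n0 free mid; apply: (le_trans (lym_pairs R F)); rewrite lerD2l.
pose E := [set p : {set 'I_n} * {set 'I_n} | [&& p.1 \in F, p.2 \in F & p.1 \proper p.2]].
pose e (p : {set 'I_n} * {set 'I_n}) : R := ('C(n, #|p.2|)%:R * 'C(#|p.2|, #|p.1|)%:R)^-1.
have -> : \sum_(B in F) \sum_(A in F | A \proper B)
    ('C(n, #|B|)%:R * 'C(#|B|, #|A|)%:R)^-1 = \sum_(p in E) e p.
  rewrite (exchange_big_dep (mem F)) /=; last by move=> B A _ /andP[].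
  rewrite pair_big_dep; apply: eq_bigl => -[A B]; rewrite inE /=.
  by case: (A \in F); rewrite ?andbF.
have w0 (A : {set 'I_n}) : 0 <= 4 / n%:R * weight A by rewrite mulr_ge0 ?divr_ge0 ?invr_ge0.
have he p : p \in E -> e p <= 4 / n%:R * weight p.1 /\ e p <= 4 / n%:R * weight p.2.
  rewrite inE => /and3P[/mid[h1 h2] /mid[h3 h4] h5]; exact: pair_weight_le.
apply: (le_trans (sum_edges_le hT w0 w0 _ _ _)).
- by move=> p /he[].
- by move=> p /he[].
- move=> [f injf hf]; apply: free.
  have fF u : f u \in F.
    have [v /orP[/andP[uv _]|/andP[uv _]]] := hasse_nbr u.
      by have := hf _ _ uv; rewrite inE => /and3P[].
    by have := hf _ _ uv; rewrite inE => /and3P[].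
  exists (fun u => exist _ (f u) (fF u)) => [u v [/injf //]|u v /=].
  rewrite le_eqVlt => /predU1P[-> //|/hf]; rewrite inE => /and3P[_ _].
  exact: proper_sub.
(* Lower and upper ends both lie in [F], so each member pays at most [4 / n] times its weight twice
   per unit of [#|T|]; hence the 8. *)
rewrite [X in _ <= X](_ : _ = #|T|%:R * (\sum_(A in F) 4 / n%:R * weight A + \sum_(A in F) 4 / n%:R * weight A)).
  rewrite ler_wpM2l // lerD // ler_sum_subset //;
  by apply/subsetP => _ /imsetP[p + ->]; rewrite inE => /and3P[].
by rewrite -mulr_sumr natrM; ring.
Qed.

Lemma middle_family_card n (F : {set {set 'I_n}}) : (0 < n)%N -> (24 * #|T| <= n)%N ->
  free_of T F ->
  {in F, forall A : {set 'I_n}, (n <= 4 * #|A|)%N /\ (4 * #|A| <= 3 * n)%N} ->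
  #|F|%:R <= (1 + (12 * #|T|)%:R / n%:R) * 'C(n, n./2)%:R :> R.
Proof.
move=> n0 nT free mid; have := middle_family_weight n0 free mid.
set S := \sum_(A in F) weight A => hS.
have n0' : 0 < n%:R :> R by rewrite ltr0n.
have FS : #|F|%:R <= S * 'C(n, n./2)%:R.
  rewrite -sumr_const mulr_suml; apply: ler_sum => A AF.
  rewrite /weight ler_pdivlMl ?ltr0n ?bin_gt0; last by have := mid A AF; lia.
  by rewrite mulr1 ler_nat leq_bin_half.
apply: (le_trans FS); rewrite ler_wpM2r //.
have S0 : 0 <= S by apply: sumr_ge0 => A _; rewrite invr_ge0.
set x : R := #|T|%:R / n%:R.
have x0 : 0 <= x by rewrite divr_ge0.
have x24 : 24 * x <= 1.
  by rewrite /x mulrA ler_pdivrMr // mul1r -natrM ler_nat.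
have xE k : (k * #|T|)%:R / n%:R = k%:R * x by rewrite natrM mulrA.
rewrite xE; move: hS; rewrite xE => hS.
(* Since [8 * x <= 1 / 3], first [S <= 3 / 2]; putting this back into [S <= 1 + 8 * x * S] gives
   [1 + 12 * x]. *)
have : S <= 1 + S / 3 by nra.
by nra.
Qed.

Lemma free_of_sub n (F G : {set {set 'I_n}}) : F \subset G -> free_of T G -> free_of T F.
Proof.
move=> /subsetP FG free [f injf hf]; apply: free.
exists (fun u => exist _ (val (f u)) (FG _ (valP (f u)))) => [u v [/val_inj/injf //]|u v].
exact: hf.
Qed.

End MiddleFamily.

From mathcomp Require Import all_classical all_reals all_analysis.
Import numFieldNormedType.Exports.
Local Open Scope classical_set_scope.
Local Open Scope ring_scope.

(** * Bounds for families with sets of every size *)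

Section LaBounds.
Context {d : Order.disp_t} {T : finPOrderType d}.
Hypothesis hT : up_down_tree T.
Variable R : realFieldType.

Lemma La_le n : (168 <= n)%N -> (24 * #|T| <= n)%N ->
  (La T n)%:R <= (1 + (16 * #|T|)%:R / n%:R) * 'C(n, n./2)%:R :> R.
Proof.
move=> n168 nT; have n0 : (0 < n)%N by lia.
have n0' : 0 < n%:R :> R by rewrite ltr0n.
have X0 : 0 <= (1 + (16 * #|T|)%:R / n%:R) * 'C(n, n./2)%:R :> R.
  by rewrite mulr_ge0 ?addr_ge0 ?divr_ge0.
rewrite /La; elim/big_ind: _ => [//|x y hx hy|F /asboolP free].
  by rewrite /maxn; case: ifP.
pose G := [set A : {set 'I_n} | (4 * #|A| < n)%N || (3 * n < 4 * #|A|)%N]%SET.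
have hG := card_outer_sets n168.
rewrite -(cardsID G F) natrD addrC.
have mid : {in F :\: G, forall A : {set 'I_n}, (n <= 4 * #|A|)%N /\ (4 * #|A| <= 3 * n)%N}.
  by move=> A; rewrite !inE negb_or -!leqNgt => /andP[/andP[]].
have h1 := middle_family_card hT R n0 nT (free_of_sub (subsetDl _ G) free) mid.
have h2 : #|F :&: G|%:R <= 4 / n%:R * 'C(n, n./2)%:R :> R.
  rewrite mulrAC ler_pdivlMr // -!natrM ler_nat mulnC; apply: leq_trans hG.
  by rewrite leq_mul2l subset_leq_card ?orbT // subsetIr.
apply: (le_trans (lerD h1 h2)); rewrite -mulrDl ler_wpM2r // -addrA lerD2l -mulrDl.
rewrite ler_wpM2r ?invr_ge0 // -natrD ler_nat.
(* The 4 from the outer sets is absorbed as [4 * #|T|], since a tree is nonempty. *)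
by have [_ [T0 _ _]] := hT; rewrite (mulnDl 12 4) leq_add2l leq_pmulr.
Qed.

Lemma bin_half_le_La n : ('C(n, n./2) <= La T n)%N.
Proof.
have -> : 'C(n, n./2) = #|[set A : {set 'I_n} | #|A| == n./2]%SET|.
  by have := card_draws 'I_n n./2; rewrite card_ord.
apply: (leq_bigmax_cond (F := fun F : {set {set 'I_n}} => #|F|)).
apply/asboolP => -[f injf hf]; have [x [y xy]] := up_down_tree_lt hT.
have := hf _ _ (ltW xy); have := valP (f x); have := valP (f y).
rewrite !inE => /eqP cy /eqP cx sub.
have /val_inj/injf exy : val (f x) = val (f y).
  by apply/eqP; rewrite eqEcard sub cx cy leqnn.
by rewrite exy ltxx in xy.
Qed.

End LaBounds.

Theorem theorem2 (R : realType) (d : Order.disp_t) (T : finPOrderType d)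
    (t : nat) (hT : up_down_tree T) (ht : #|T| = t) :
  (exists2 g : nat -> R,
     g =O_\oo (fun n : nat => (n%:R * Num.sqrt (n%:R * ln (n%:R : R)))^-1) &
     \forall n \near \oo,
       (La T n)%:R
         <= (1 + (16 * t)%:R / n%:R + g n) * ('C(n, n./2))%:R)
  /\ (fun n : nat => (La T n)%:R / ('C(n, n./2))%:R : R) @ \oo --> (1 : R).
Proof.
have near_le : \forall n \near \oo,
    (La T n)%:R <= (1 + (16 * t)%:R / n%:R) * ('C(n, n./2))%:R :> R.
  near=> n; rewrite -ht; apply: La_le => //; near: n; exact: nbhs_infty_ge.
split.
  exists (fun=> 0).
    apply/eqOP; exists 0; split=> // k /ltW k0; apply: nearW => n.
    by rewrite normr0 mulr_ge0.
  by apply: filterS near_le => n; rewrite addr0.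
(* [harmonic n] is [1 / (n + 1)], and [n + 1 <= 2 * n] for positive [n], so 16 is doubled to 32. *)
apply: (squeeze_cvgr (f := fun=> 1) (h := fun n => 1 + (32 * t)%:R * harmonic n)).
- near=> n.
  have n0 : (0 < n)%N by near: n; exact: nbhs_infty_ge.
  have n0' : 0 < n%:R :> R by rewrite ltr0n.
  have c0 : 0 < 'C(n, n./2)%:R :> R.
    by rewrite ltr0n bin_gt0; lia.
  rewrite ler_pdivlMr // mul1r ler_nat bin_half_le_La //=.
  rewrite ler_pdivrMr //; apply: (@le_trans _ _ ((1 + (16 * t)%:R / n%:R) * ('C(n, n./2))%:R)).
    by near: n.
  rewrite ler_wpM2r // lerD2l /harmonic /= ler_pdivlMr // mulrAC ler_pdivrMr //.
  rewrite -!natrM ler_nat; nia.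
- exact: cvg_cst.
- rewrite -[X in _ --> X]addr0 -(mulr0 (32 * t)%:R).
  by apply: cvgD; [exact: cvg_cst | apply: cvgM; [exact: cvg_cst | exact: cvg_harmonic]].
Unshelve. all: by end_near.
Qed.
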